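(* (Law of Quotation.) For every eval-free expression $\mathbf{A}_\alpha$ of $\mathrm{CTT}_{\mathrm{qe}}$, the formula $\ulcorner\mathbf{A}_\alpha\urcorner=\mathcal{E}(\mathbf{A}_\alpha)$ is valid in every model of $\mathrm{CTT}_{\mathrm{qe}}$.
   Context: $\mathrm{CTT}_{\mathrm{qe}}$ is a version of Church's type theory with quotation and evaluation. Types: $\iota$, $o$, $\epsilon$ are types, and if $\alpha,\beta$ are types then $(\alpha\to\beta)$ is a type; $\mathcal{T}$ is the set of types. $\mathcal{V}$ is a set of typed symbols (variables $\mathbf{x}_\alpha$), denumerably many per type; $\mathcal{C}$ is a disjoint set of typed symbols (constants $\mathbf{c}_\alpha$) containing the logical constants $=_{\alpha\to\alpha\to o}$ (every $\alpha$), $\mathrm{is\text{-}var}_{\epsilon\to o}$, $\mathrm{is\text{-}con}_{\epsilon\to o}$, $\mathrm{app}_{\epsilon\to\epsilon\to\epsilon}$, $\mathrm{abs}_{\epsilon\to\epsilon\to\epsilon}$, $\mathrm{quo}_{\epsilon\to\epsilon}$, $\mathrm{is\text{-}expr}^{\alpha}_{\epsilon\to o}$ (every $\alpha$). Expressions: variables and constants; applications $(\mathbf{F}_{\alpha\to\beta}\,\mathbf{A}_\alpha)$ of type $\beta$; abstractions $(\lambda\,\mathbf{x}_\alpha.\mathbf{B}_\beta)$ of type $\alpha\to\beta$; quotations $\ulcorner\mathbf{A}_\alpha\urcorner$ of type $\epsilon$ for eval-free $\mathbf{A}_\alpha$; evaluations $[\![\mathbf{A}_\epsilon]\!]_{\mathbf{B}_\beta}$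 (abbreviated $[\![\mathbf{A}_\epsilon]\!]_\beta$) of type $\beta$. Eval-free means built without the evaluation rule. $(\mathbf{A}_\alpha=\mathbf{B}_\alpha)$ abbreviates $=_{\alpha\to\alpha\to o}\,\mathbf{A}_\alpha\,\mathbf{B}_\alpha$. Constructions: $\ulcorner\mathbf{x}_\alpha\urcorner$, $\ulcorner\mathbf{c}_\alpha\urcorner$ are constructions, and if $\mathbf{A}_\epsilon,\mathbf{B}_\epsilon$ are constructions then so are the expressions $\mathrm{app}\,\mathbf{A}_\epsilon\,\mathbf{B}_\epsilon$, $\mathrm{abs}\,\mathbf{A}_\epsilon\,\mathbf{B}_\epsilon$, $\mathrm{quo}\,\mathbf{A}_\epsilon$. The map $\mathcal{E}$ from eval-free expressions to constructions: $\mathcal{E}(\mathbf{x}_\alpha)=\ulcorner\mathbf{x}_\alpha\urcorner$, $\mathcal{E}(\mathbf{c}_\alpha)=\ulcorner\mathbf{c}_\alpha\urcorner$, $\mathcal{E}(\mathbf{F}\mathbf{A})=\mathrm{app}\,\mathcal{E}(\mathbf{F})\,\mathcal{E}(\mathbf{A})$, $\mathcal{E}(\lambda\mathbf{x}_\alpha.\mathbf{B})=\mathrm{abs}\,\mathcal{E}(\mathbf{x}_\alpha)\,\mathcal{E}(\mathbf{B})$, $\mathcal{E}(\ulcorner\mathbf{A}\urcorner)=\mathrm{quo}\,\mathcal{E}(\mathbf{A})$. Frame: $D_\iota$ nonempty, $D_o=\{\mathrm{T},\mathrm{F}\}$, $D_\epsilon$ = the set of constructions, $D_{\alpha\to\beta}$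 = all total functions $D_\alpha\to D_\beta$. Interpretation: frame plus $I$ on constants with $I(\mathbf{c}_\alpha)\in D_\alpha$, where $I(=_{\alpha\to\alpha\to o})$ is the identity relation on $D_\alpha$; $I(\mathrm{is\text{-}var})(\mathbf{A})=\mathrm{T}$ iff $\mathbf{A}$ is a quoted variable; $I(\mathrm{is\text{-}con})(\mathbf{A})=\mathrm{T}$ iff $\mathbf{A}$ is a quoted constant; $I(\mathrm{app})(\mathbf{A})(\mathbf{B})$ is the construction $\mathrm{app}\,\mathbf{A}\,\mathbf{B}$, $I(\mathrm{abs})(\mathbf{A})(\mathbf{B})$ is $\mathrm{abs}\,\mathbf{A}\,\mathbf{B}$, $I(\mathrm{quo})(\mathbf{A})$ is $\mathrm{quo}\,\mathbf{A}$; $I(\mathrm{is\text{-}expr}^\alpha)(\mathbf{A})=\mathrm{T}$ iff $\mathbf{A}=\mathcal{E}(\mathbf{B}_\alpha)$ for some eval-free $\mathbf{B}_\alpha$. Assignments $\phi$ map variables $\mathbf{x}_\alpha$ into $D_\alpha$. Model: an interpretation $\mathcal{M}$ with a function $V^{\mathcal{M}}$, $V_\phi(\mathbf{C}_\gamma)\in D_\gamma$, satisfying: (1) $V_\phi(\mathbf{x})=\phi(\mathbf{x})$; (2) $V_\phi(\mathbf{c})=I(\mathbf{c})$; (3) $V_\phi(\mathbf{F}\mathbf{A})=V_\phi(\mathbf{F})(V_\phi(\mathbf{A}))$; (4) $V_\phi(\lambda\mathbf{x}_\alpha.\mathbf{B})$ is $d\mapsto V_{\phi[\mathbf{x}_\alpha\mapsto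 d]}(\mathbf{B})$; (5) $V_\phi(\ulcorner\mathbf{A}_\alpha\urcorner)=\mathcal{E}(\mathbf{A}_\alpha)$; (6) if $V_\phi(\mathrm{is\text{-}expr}^\beta\,\mathbf{A}_\epsilon)=\mathrm{T}$ then $V_\phi([\![\mathbf{A}_\epsilon]\!]_\beta)=V_\phi(\mathcal{E}^{-1}(V_\phi(\mathbf{A}_\epsilon)))$. A formula $\mathbf{A}_o$ is valid in $\mathcal{M}$ if $V^{\mathcal{M}}_\phi(\mathbf{A}_o)=\mathrm{T}$ for all assignments $\phi$. *)

(* Defs.v *)
From HB Require Import structures.
From mathcomp Require Import all_boot.

Set Implicit Arguments.
Unset Strict Implicit.
Unset Printing Implicit Defensive.

Inductive ty : Type :=
| Iota
| Omicron
| Epsilon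
| Arrow of ty & ty.

Declare Scope ctt_scope.
Delimit Scope ctt_scope with ctt.
Open Scope ctt_scope.
Notation "a →' b" := (Arrow a b)
  (at level 55, right associativity) : ctt_scope.

Lemma ty_eq_dec : comparable ty.
Proof. by rewrite /comparable /decidable; decide equality. Defined.

HB.instance Definition _ := hasDecEq.Build ty (compareP ty_eq_dec).

(* The language is parameterized by the typed symbols it leaves open: the
   variables, and the constants other than the logical ones.  The equality
   test on variables serves only to define the update of an assignment. *)
Record signature := Signature {
  var : ty -> eqType;
  var_denumerable : forall a, exists f : nat -> var a, bijective f;
  nonlogical : ty -> Type
}.

Inductive con (S : signature) : ty -> Type :=
| CEq a : con S (a →' a →' Omicron)
| CIsVar : con S (Epsilon →' Omicron)
| CIsCon : con S (Epsilon →' Omicron)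
| CApp : con S (Epsilon →' Epsilon →' Epsilon)
| CAbs : con S (Epsilon →' Epsilon →' Epsilon)
| CQuo : con S (Epsilon →' Epsilon)
| CIsExpr (a : ty) : con S (Epsilon →' Omicron)
| CNonlogical a (c : nonlogical S a) : con S a.

Arguments CEq {S}.
Arguments CIsVar {S}.
Arguments CIsCon {S}.
Arguments CApp {S}.
Arguments CAbs {S}.
Arguments CQuo {S}.
Arguments CIsExpr {S}.

(* [expr S e a] is the type of the expressions of type [a] that are eval-free
   if [e = true] and contain an evaluation if [e = false].  The index [e] is
   determined by the expression: it is what lets the quotation rule demand an
   eval-free argument within a single inductive definition.  The second
   argument of [Eval] only carries the type of the evaluation. *)
Inductive expr (S : signature) : bool -> ty -> Type :=
| Var a (x : var S a) : expr S true a
| Con a (c : con S a) : expr S true a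
| App e1 e2 a b (F : expr S e1 (a →' b)) (A : expr S e2 a) :
    expr S (e1 && e2) b
| Abs e a b (x : var S a) (B : expr S e b) : expr S e (a →' b)
| Quo a (A : expr S true a) : expr S true Epsilon
| Eval e1 e2 b (A : expr S e1 Epsilon) (B : expr S e2 b) : expr S false b.

Arguments Con {S a}.

Definition Eq S e1 e2 a (A : expr S e1 a) (B : expr S e2 a) :
    expr S (e1 && e2) Omicron :=
  App (App (Con (CEq a)) A) B.

Definition AppE S (A B : expr S true Epsilon) : expr S true Epsilon :=
  App (App (Con CApp) A) B.
Definition AbsE S (A B : expr S true Epsilon) : expr S true Epsilon :=
  App (App (Con CAbs) A) B.
Definition QuoE S (A : expr S true Epsilon) : expr S true Epsilon :=
  App (Con CQuo) A.

Inductive is_construction (S : signature) : expr S true Epsilon -> Prop :=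
| CoVar a (x : var S a) : is_construction (Quo (Var x))
| CoCon a (c : con S a) : is_construction (Quo (Con c))
| CoApp A B :
    is_construction A -> is_construction B -> is_construction (AppE A B)
| CoAbs A B :
    is_construction A -> is_construction B -> is_construction (AbsE A B)
| CoQuo A : is_construction A -> is_construction (QuoE A).

Record construction (S : signature) := Construction {
  construction_expr :> expr S true Epsilon;
  constructionP : is_construction construction_expr
}.

Definition coVar S a (x : var S a) : construction S := Construction (CoVar x).
Definition coCon S a (c : con S a) : construction S := Construction (CoCon c).
Definition coApp S (A B : construction S) : construction S :=
  Construction (CoApp (constructionP A) (constructionP B)).
Definition coAbs S (A B : construction S) : construction S :=
  Construction (CoAbs (constructionP A) (constructionP B)).
Definition coQuo S (A : construction S) : construction S :=
  Construction (CoQuo (constructionP A)).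

Lemma andb_left (b c : bool) : b && c -> b. Proof. by case/andP. Qed.
Lemma andb_right (b c : bool) : b && c -> c. Proof. by case/andP. Qed.

Fixpoint encode_rec S e a (A : expr S e a) : e -> construction S :=
  match A in expr _ e _ return e -> construction S with
  | Var _ x => fun _ => coVar x
  | Con _ c => fun _ => coCon c
  | App _ _ _ _ F A => fun h =>
      coApp (encode_rec F (andb_left h)) (encode_rec A (andb_right h))
  | Abs _ _ _ x B => fun h => coAbs (coVar x) (encode_rec B h)
  | Quo _ A => fun _ => coQuo (encode_rec A isT)
  | Eval _ _ _ _ _ => fun h => False_rect _ (notF h)
  end.

(* The map written with a calligraphic E *)
Definition encode S a (A : expr S true a) : construction S :=
  encode_rec A isT.

(* A left inverse of [encode], used only to prove that it is injective *)
Definition decoded S := option {a : ty & expr S true a}.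

Definition decode_app S (F A : decoded S) : decoded S :=
  match F, A with
  | Some (existT (Arrow a b) F'), Some (existT a' A') =>
      if a' =P a is ReflectT e then
        Some (Tagged (expr S true) (App F' (ecast a (expr S true a) e A')))
      else None
  | _, _ => None
  end.

Definition decode_abs S (X B : decoded S) : decoded S :=
  match X, B with
  | Some (existT _ (Var _ x)), Some (existT _ B') =>
      Some (Tagged (expr S true) (Abs x B'))
  | _, _ => None
  end.

Definition decode_quo S (A : decoded S) : decoded S :=
  if A is Some (existT _ A') then Some (Tagged (expr S true) (Quo A'))
  else None.

Fixpoint decode S e a (A : expr S e a) : decoded S :=
  match A with
  | Quo a A => Some (Tagged (expr S true) A)
  | App _ _ _ _ (App _ _ _ _ (Con _ CApp) A) B =>
      decode_app (decode A) (decode B)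
  | App _ _ _ _ (App _ _ _ _ (Con _ CAbs) A) B =>
      decode_abs (decode A) (decode B)
  | App _ _ _ _ (Con _ CQuo) A => decode_quo (decode A)
  | _ => None
  end.

Lemma encode_recK S e a (A : expr S e a) (h : e = true) :
  decode (encode_rec A h) =
  Some (Tagged (expr S true) (ecast e (expr S e a) h A)).
Proof.
elim: A h => {e a}
  [a x|a c|e1 e2 a b F IHF A IHA|e a b x B IH|a A IH|e1 e2 b A _ B _] h //=.
- by rewrite eq_axiomK.
- by rewrite eq_axiomK.
- have [h1 h2] : e1 = true /\ e2 = true by case/andP: (h).
  rewrite (IHF (andb_left h)) (IHA (andb_right h)) /=.
  move: (andb_left h) (andb_right h).
  subst e1 e2; rewrite (eq_axiomK h) => k1 k2.
  rewrite (eq_axiomK k1) (eq_axiomK k2) /=.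
  by case: eqP => // e; rewrite (eq_axiomK e).
- by case: e h B IH => // h B IH; rewrite IH (eq_axiomK h).
- by rewrite IH /= (eq_axiomK h) (eq_axiomK isT).
Qed.

Lemma encode_inj S a : injective (@encode S a).
Proof.
move=> A B eAB; apply: (@eq_from_Tagged _ (expr S true)).
have dK (C : expr S true a) :
    decode (encode C) = Some (Tagged (expr S true) C).
  by rewrite encode_recK (eq_axiomK isT).
by apply: Some_inj; rewrite -!dK eAB.
Qed.

Fixpoint domain (S : signature) (Di : Type) (a : ty) : Type :=
  match a with
  | Iota => Di
  | Omicron => bool
  | Epsilon => construction S
  | Arrow a b => domain S Di a -> domain S Di b
  end.

Record interpretation (S : signature) := Interpretation {
  Diota : Type;
  Diota_nonempty : inhabited Diota;
  I : forall a, con S a -> domain S Diota a;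
  I_eq : forall a (d d' : domain S Diota a), I (CEq a) d d' = true <-> d = d';
  I_is_var : forall A : construction S,
    I CIsVar A = true <-> exists a (x : var S a), A = coVar x;
  I_is_con : forall A : construction S,
    I CIsCon A = true <-> exists a (c : con S a), A = coCon c;
  I_app : forall A B : construction S, I CApp A B = coApp A B;
  I_abs : forall A B : construction S, I CAbs A B = coAbs A B;
  I_quo : forall A : construction S, I CQuo A = coQuo A;
  I_is_expr : forall a (A : construction S),
    I (CIsExpr a) A = true <-> exists B : expr S true a, A = encode B
}.

Definition D S (M : interpretation S) (a : ty) : Type := domain S (Diota M) a.

Definition assignment S (M : interpretation S) : Type :=
  forall v : {a : ty & var S a}, D M (tag v).

Definition update S (M : interpretation S) (phi : assignment M)
    a (x : var S a) (d : D M a) : assignment M :=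
  @dfwith _ (fun v : {a : ty & var S a} => D M (tag v)) phi
    (Tagged (fun a => var S a) x) d.

(* In [V_eval], [C] ranges over the eval-free expressions of type [b] whose
   encoding is the value of [A], i.e. over the inverse image of that value;
   by [encode_inj] there is only one, and the premise on is-expr says
   that there is one.  Nothing constrains the value of an evaluation when
   that premise fails. *)
Record model (S : signature) := Model {
  interp :> interpretation S;
  V : assignment interp -> forall e a, expr S e a -> D interp a;
  V_var : forall phi a (x : var S a),
    V phi (Var x) = phi (Tagged (fun a => var S a) x);
  V_con : forall phi a (c : con S a), V phi (Con c) = I interp c;
  V_app : forall phi e1 e2 a b (F : expr S e1 (a →' b)) (A : expr S e2 a),
    V phi (App F A) = V phi F (V phi A);
  V_abs : forall phi e a b (x : var S a) (B : expr S e b),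
    V phi (Abs x B) = fun d => V (update phi x d) B;
  V_quo : forall phi a (A : expr S true a), V phi (Quo A) = encode A;
  V_eval : forall phi e1 e2 b (A : expr S e1 Epsilon) (B : expr S e2 b),
    V phi (App (Con (CIsExpr b)) A) = true ->
    forall C : expr S true b, V phi A = encode C -> V phi (Eval A B) = V phi C
}.

Definition valid S (M : model S) e (A : expr S e Omicron) : Prop :=
  forall phi : assignment M, V phi A = true.

(* Main.v *)
Require Import Defs.
From mathcomp Require Import all_boot.

(** The theorem reduces to the fact that a construction in the image of [encode]
    denotes itself: app, abs and quo are interpreted as the constructors of
    constructions, and a quotation denotes the encoding of its body. *)

Section ConstructionsDenoteThemselves.

Variables (S : signature) (M : model S) (phi : assignment M).

Lemma V_coApp (A B : construction S) :
  V phi A = A -> V phi B = B -> V phi (coApp A B) = coApp A B.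
Proof.
(* [coApp A B], seen as an expression, is an application only up to conversion, hence [etrans] in
   place of a rewrite. *)
move=> VA VB; apply: etrans (V_app phi (App (Con CApp) A) B) _.
by rewrite (V_app phi (Con CApp) A) V_con VA VB I_app.
Qed.

Lemma V_coAbs (A B : construction S) :
  V phi A = A -> V phi B = B -> V phi (coAbs A B) = coAbs A B.
Proof.
move=> VA VB; apply: etrans (V_app phi (App (Con CAbs) A) B) _.
by rewrite (V_app phi (Con CAbs) A) V_con VA VB I_abs.
Qed.

Lemma V_coQuo (A : construction S) : V phi A = A -> V phi (coQuo A) = coQuo A.
Proof.
move=> VA; apply: etrans (V_app phi (Con CQuo) A) _.
by rewrite V_con VA I_quo.
Qed.

(** A general index [e] lets the induction reach every subexpression; [h] then excludes
    evaluations. *)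
Lemma V_encode_rec e a (A : expr S e a) (h : e) :
  V phi (encode_rec A h) = encode_rec A h.
Proof.
elim: A h => {e a} [a x|a c|e1 e2 a b F IHF A IHA|e a b x B IHB|a A IHA|//] h.
- exact: V_quo.
- exact: V_quo.
- by apply: V_coApp; [apply: IHF | apply: IHA].
(* The encoding of an abstraction binds nothing: it applies [CAbs] to a quoted variable, so [phi]
   stays fixed. *)
- by apply: V_coAbs; [apply: V_quo | apply: IHB].
- exact/V_coQuo/IHA.
Qed.

End ConstructionsDenoteThemselves.

Theorem theorem1 (S : signature) (a : ty) (A : expr S true a) (M : model S) :
  valid M (Eq (Quo A) (encode A)).
Proof.
move=> phi; rewrite /Eq V_app (V_app phi (Con (CEq _)) (Quo A)) V_con.
by apply/I_eq; rewrite V_quo /encode V_encode_rec.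
Qed.
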